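(* If UE $k \in \mathcal{S}_t$ estimates $\alpha_t$ as \begin{equation} \hat{\alpha}_{t,k} = \max \bigg( \bigg( \frac{\Gamma \left( M + \frac{1}{2} \right) }{ \Gamma \left( M \right) } \bigg)^2 \frac{ q \rho_k \beta_k^2 \tau_p^2 }{ \left( \Re ( z_k ) \right)^2 } - \sigma^2, \, \rho_k \beta_k \tau_p \bigg) \end{equation} and repeats its pilot if and only if $\rho_k\beta_k\tau_p > \hat{\alpha}_{t,k}/2+\epsilon_k$ (event $\mathcal{R}_k$), with bias $\epsilon_k < \rho_k \beta_k \tau_p/2$, then \begin{equation} \Pr \{ \mathcal{R}_{k} \} = 1 - \Pr \{ \Re ( z_k ) \leq \sqrt{\zeta_k} \} + \Pr \{ \Re ( z_k ) \leq - \sqrt{\zeta_k} \} \end{equation} where \begin{equation} \zeta_k = \bigg( \frac{\Gamma \left( M + \frac{1}{2} \right) }{ \Gamma \left( M \right) } \bigg)^2 \frac{q \rho_k \beta_k^2 \tau_p^2 }{\sigma^2+2( \rho_k \beta_k \tau_p - \epsilon_k) } \end{equation} and \begin{align} & \Pr \{ \Re ( z_k ) \leq b \} = Q \left(-\frac{b \sqrt{2}}{\sqrt{\lambda_2}} \right) - \sum_{k=0}^{M-1} \frac{ e^{- \frac{b^2}{\lambda_2} \left( 1 - \frac{\lambda_1}{\lambda_1 + \lambda_2} \right)} }{\Gamma(k+1) \lambda_1^k \sqrt{\pi \lambda_2 }} \notag \\ & \times \sum_{n=0}^{2k} {2k \choose n} \frac{\left( \Gamma \left( \frac{n+1}{2}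 \right) + c_n(b) \gamma \left( \frac{n+1}{2} , \frac{b^2}{\lambda_2} \frac{\lambda_1}{\lambda_1+\lambda_2} \right) \right) }{ 2 \left( \frac{b}{\lambda_2} \right)^{n-2k} \left( \frac{1}{\lambda_1} + \frac{1}{\lambda_2} \right)^{2k+\frac{1}{2}-\frac{n}{2}} } . \end{align} Here $Q(x)=\frac{1}{\sqrt{2 \pi}} \int_{x}^{\infty} e^{-t^2/2}dt$, $\gamma(\cdot,\cdot)$ is the lower incomplete gamma function, $c_n(b)=(-1)^n$ if $b\ge0$ and $c_n(b)=-1$ if $b<0$, $\lambda_1 = \frac{\rho_k q \beta_k^2 \tau_p^2}{\alpha_t + \sigma^2}$ and $\lambda_2 = \sigma^2 + \Upsilon_k + q \beta_k \tau_p - \lambda_1$.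
   Context: A BS with $M$ antennas; $\tau_p$ orthogonal uplink pilots $\boldsymbol{\psi}_t$ with $\|\boldsymbol{\psi}_t\|^2=\tau_p$; $\mathcal{S}_t$ is the set of UEs sending pilot $t$, UE $i$ using power $\rho_i>0$. Uncorrelated Rayleigh fading $\mathbf{h}_k\sim\mathcal{CN}(\mathbf{0},\beta_k\mathbf{I}_M)$, independent across UEs. The BS obtains $\mathbf{y}_t=\sum_{i\in\mathcal{S}_t}\sqrt{\rho_i\tau_p}\,\mathbf{h}_i+(\text{inter-cell interference of per-antenna power }\omega_t)+\mathbf{n}_t$, $\mathbf{n}_t\sim\mathcal{CN}(\mathbf{0},\sigma^2\mathbf{I}_M)$, and $\alpha_t=\sum_{i\in\mathcal{S}_t}\rho_i\beta_i\tau_p+\omega_t$. It transmits $\mathbf{V}=\sqrt{q}\sum_t\frac{\mathbf{y}_t^*}{\|\mathbf{y}_t\|}\boldsymbol{\phi}_t^{\mathrm{T}}$ with orthogonal $\boldsymbol{\phi}_t$, $\|\boldsymbol{\phi}_t\|^2=\tau_p$. UE $k\in\mathcal{S}_t$ observes $z_k=\sqrt{q\tau_p}\,\mathbf{h}_k^{\mathrm{T}}\frac{\mathbf{y}_t^*}{\|\mathbf{y}_t\|}+\boldsymbol{\upsilon}_k^{\mathrm{T}}\frac{\boldsymbol{\phi}_t^*}{\|\boldsymbol{\phi}_t\|}+\eta_k$ with $\boldsymbol{\upsilon}_k\sim\mathcal{CN}(\mathbf{0},\Upsilon_k\mathbf{I}_{\tau_p})$ independent inter-cell interference and $\eta_k\sim\mathcal{CN}(0,\sigma^2)$;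 thus $z_k=g_k+\nu_k$ with independent $g_k=\sqrt{\lambda_1/2}\,x$, $x\sim\chi_{2M}$, and $\nu_k\sim\mathcal{CN}(0,\lambda_2)$. *)

(* Defs.v *)
From HB Require Import structures.
From mathcomp Require Import all_boot all_order all_algebra.
From mathcomp Require Import all_classical all_reals all_analysis.
Set Implicit Arguments. Unset Strict Implicit. Unset Printing Implicit Defensive.
Import Order.TTheory GRing.Theory Num.Def Num.Theory.
Import numFieldNormedType.Exports.
Local Open Scope classical_set_scope.
Local Open Scope ring_scope.

Section defs.
Variable R : realType.
Notation mu := (@lebesgue_measure R).

Definition Gamma (s : R) : R :=
  fine (\int[mu]_(t in `]0%R, +oo[) (t `^ (s - 1) * expR (- t))%:E)%E.

Definition lgamma (s x : R) : R :=
  fine (\int[mu]_(t in `]0%R, x[) (t `^ (s - 1) * expR (- t))%:E)%E.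

Definition Qfun (x : R) : R :=
  (Num.sqrt (2 * pi))^-1 *
  fine (\int[mu]_(t in `[x, +oo[) (expR (- (t ^+ 2) / 2))%:E)%E.

(* density of the chi distribution with 2M degrees of freedom:
   x^(2M-1) e^(-x^2/2) / (2^(M-1) Gamma(M)) on x >= 0, with Gamma(M) = (M-1)! *)
Definition chi2M_pdf (M : nat) (x : R) : R :=
  if 0 <= x then
    x ^+ (2 * M).-1 * expR (- (x ^+ 2) / 2) / (2 ^+ M.-1 * (M.-1)`!%:R)
  else 0.

Definition cn (n : nat) (b : R) : R := if 0 <= b then (-1) ^+ n else -1.

(* the closed form claimed for Pr{Re(z_k) <= b}; the factor
   1/(b/lambda2)^(n-2k) is written as (b/lambda2)^(2k-n) (2k-n >= 0) *)
Definition cdf_formula (M : nat) (l1 l2 b : R) : R :=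
  Qfun (- (b * Num.sqrt 2) / Num.sqrt l2)
  - \sum_(j < M)
      expR (- (b ^+ 2 / l2) * (1 - l1 / (l1 + l2)))
      / ((j`!)%:R * l1 ^+ j * Num.sqrt (pi * l2))
      * \sum_(n < (2 * j).+1)
          'C(2 * j, n)%:R
          * (Gamma ((n%:R + 1) / 2)
             + cn n b * lgamma ((n%:R + 1) / 2) (b ^+ 2 / l2 * (l1 / (l1 + l2))))
          * (b / l2) ^+ (2 * j - n)
          / (2 * (l1^-1 + l2^-1) `^ ((2 * j)%:R + 2^-1 - n%:R / 2)).

Definition gratio (M : nat) : R := Gamma (M%:R + 2^-1) / Gamma M%:R.

Definition alpha_hat (M : nat) (q rhok betak tau sigma2 r : R) : R :=
  Num.max (gratio M ^+ 2 * q * rhok * betak ^+ 2 * tau ^+ 2 / r ^+ 2 - sigma2)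
          (rhok * betak * tau).

Definition repeats (M : nat) (q rhok betak tau sigma2 eps r : R) : Prop :=
  alpha_hat M q rhok betak tau sigma2 r / 2 + eps < rhok * betak * tau.

Definition zeta (M : nat) (q rhok betak tau sigma2 eps : R) : R :=
  gratio M ^+ 2 * q * rhok * betak ^+ 2 * tau ^+ 2
  / (sigma2 + 2 * (rhok * betak * tau - eps)).

End defs.

(* Main.v *)
(** Conditioning on the noise and inserting the chi tail
    [P(g > x) = exp(-x^2/l1) * sum_(j < M) (x^2/l1)^j / j!], the distribution
    function of [Re z = g + nu] at [b] is the Gaussian one minus integrals of
    [(b-x)^(2j) exp(-(b-x)^2/l1) exp(-x^2/l2)] over [x <= b].  Completing the
    square and expanding binomially leaves tails of [v^n exp(-v^2)], which the
    substitution [t = v^2] turns into complete and incomplete Gamma functions.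
    The UE repeats iff [|Re z| > sqrt zeta], up to an event of probability zero. *)

Require Import Defs.
From HB Require Import structures.
From mathcomp Require Import all_boot all_order all_algebra.
From mathcomp Require Import all_classical all_reals all_analysis.
From mathcomp Require Import measurable_realfun ring lra.
Set Implicit Arguments.
Unset Strict Implicit.
Unset Printing Implicit Defensive.
Import Order.TTheory GRing.Theory Num.Def Num.Theory.
Import numFieldNormedType.Exports.
Local Open Scope classical_set_scope.
Local Open Scope ring_scope.

(** * Moments of [exp(-x^2)] over half-lines *)

Section gauss_moments.
Variable R : realType.
Notation mu := (@lebesgue_measure R).
Implicit Types (n : nat) (a b c x : R).

Definition gauss_moment n x := x ^+ n * expR (- x ^+ 2).

Lemma continuous_gauss_moment n : continuous (gauss_moment n).
Proof.
move=> x; apply: cvgM; first exact: exprn_continuous.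
exact: continuous_gauss_fun.
Qed.

Lemma measurable_gauss_moment n D : measurable_fun D (gauss_moment n).
Proof.
apply: measurable_funTS; apply: measurable_funM => //.
exact: measurable_gauss_fun.
Qed.

(** A multiple of the standard normal density, which decays only like [exp(-x^2 / 2)], dominates the
    moment. *)
Lemma integrable_gauss_moment n : mu.-integrable setT (EFin \o gauss_moment n).
Proof.
(* With [y = x^2 / 2] the bound is [|x|^n <= 1 + 2^(n+1) y^(n+1)]; the summand 1 of [K] comes from
   [1 <= exp y], the other from [y^(n+1) <= (n+1)! exp y]. *)
set K : R := 2 ^+ n.+1 * (n.+1)`!%:R + 1.
set p := @normal_peak R 1.
have p0 : 0 < p by apply: normal_peak_gt0; rewrite oner_neq0.
apply: (@le_integrable _ _ _ mu setT measurableT _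
   (EFin \o (fun x => K * p^-1 * normal_pdf 0 1 x))).
- by apply/measurable_EFinP; exact: measurable_gauss_moment.
(* half of the exponent absorbs [|x|^n], by [y^(n+1)/(n+1)! <= exp y] *)
- move=> x _; rewrite /= lee_fin.
  rewrite normal_pdfE ?oner_neq0// /normal_fun -/p subr0 expr1n.
  rewrite mulrA mulfVK ?gt_eqF// /gauss_moment normrM normrX.
  rewrite (ger0_norm (expR_ge0 _)).
  apply: (le_trans _ (ler_norm _)).
  have -> : expR (- x ^+ 2) = expR (- x ^+ 2 / 2) * expR (- x ^+ 2 / 2).
    by rewrite -expRD; congr expR; field.
  rewrite mulrA ler_wpM2r ?expR_ge0//.
  rewrite mulNr expRN ler_pdivrMr ?expR_gt0//.
  set y := x ^+ 2 / 2.
  have y0 : 0 <= y by rewrite divr_ge0// sqr_ge0.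
  have h1 := expR_ge1Dxn n y0.
  have h2 : 1 <= expR y by rewrite -expR0 ler_expR.
  (* Below 1 the power is at most 1; above 1 it grows with the exponent, and the even exponent
     [2 (n+1)] makes it a power of [y]. *)
  have h3 : `|x| ^+ n <= 1 + 2 ^+ n.+1 * y ^+ n.+1.
    rewrite -exprMn /y mulrC mulfVK ?pnatr_eq0// -real_normK ?num_real//.
    rewrite -exprM; set z := `|x|; have z0 : 0 <= z by exact: normr_ge0.
    have [z1|/ltW z1] := leP z 1.
      by rewrite (@le_trans _ _ 1)// ?exprn_ile1// lerDl exprn_ge0.
    rewrite (@le_trans _ _ (z ^+ (2 * n.+1)))//; last by rewrite lerDr.
    by rewrite ler_weXn2l// mulnS mul2n -addnn addnA leq_addl.
  apply: (le_trans h3); rewrite /K mulrDl mul1r addrC lerD//.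
  rewrite -mulrA ler_wpM2l ?exprn_ge0// -ler_pdivrMl ?ltr0n ?fact_gt0//.
  rewrite mulrC; apply: le_trans h1; by rewrite lerDr.
- exact: (integrableZl measurableT (K * p^-1) (integrable_normal_pdf 0 1)).
Qed.

Lemma integrable_gauss_moment_sub n D : measurable D ->
  mu.-integrable D (EFin \o gauss_moment n).
Proof. by move=> mD; apply: integrableS (integrable_gauss_moment n). Qed.

Definition gauss_tail n c := \int[mu]_(x in `[c, +oo[) gauss_moment n x.

Lemma gauss_tailE n c :
  (\int[mu]_(x in `[c, +oo[) (gauss_moment n x)%:E = (gauss_tail n c)%:E)%E.
Proof.
rewrite /gauss_tail /Rintegral fineK//; apply: integrable_fin_num => //.
exact: integrable_gauss_moment_sub.
Qed.

(** By parity, the integral over [[-c, 0]] is [(-1)^n] times the one over [[0, c]]. *)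
Lemma gauss_tailN n c : 0 <= c ->
  gauss_tail n (- c) = gauss_tail n 0 + (-1) ^+ n * (gauss_tail n 0 - gauss_tail n c).
Proof.
rewrite le_eqVlt => /predU1P[<-|c0]; first by rewrite oppr0 subrr mulr0 addr0.
have split (x y : R) : x < y ->
    gauss_tail n x = \int[mu]_(t in `[x, y]) gauss_moment n t + gauss_tail n y.
  move=> xy; have := @Rintegral_itvB R (gauss_moment n) (BLeft x) (BInfty _ false) y.
  move=> /(_ (integrable_gauss_moment_sub _ (measurable_itv _))).
  rewrite bnd_simp ltW// bnd_simp => /(_ isT isT).
  rewrite Rintegral_itv_obnd_cbnd; last exact: integrable_gauss_moment_sub.
  rewrite -/(gauss_tail n x) -/(gauss_tail n y) => <-; ring.
rewrite (split _ 0) ?oppr_lt0// addrC (split 0 c c0); congr (_ + _).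
rewrite addrK -RintegralZl//; last exact: integrable_gauss_moment_sub.
have := @integration_by_substitution_oppr R (gauss_moment n) 0 c (ltW c0).
rewrite oppr0 /Rintegral => ->; last exact/continuous_subspaceT/continuous_gauss_moment.
congr fine; apply: eq_integral => x _.
by rewrite /gauss_moment /= [(- x) ^+ n]exprNn sqrrN mulrA.
Qed.

(** * The substitution [t = v^2] in the Gamma integrals *)

Let gamma_kernel (s t : R) := t `^ (s - 1) * expR (- t).

Lemma continuous_gamma_kernel s t : 0 < t -> {for t, continuous (gamma_kernel s)}.
Proof.
move=> t0; rewrite /gamma_kernel.
apply: (@continuousM R R (fun t => t `^ (s - 1))
  (fun t => expR (- t))).
  apply: differentiable_continuous; apply/derivable1_diffP.
  by apply: derivable_powR; rewrite in_itv/= t0.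
apply: continuous_comp; first exact: opp_continuous.
exact: continuous_expR.
Qed.

Lemma measurable_gamma_kernel s D : measurable_fun D (gamma_kernel s).
Proof.
apply: measurable_funTS; apply: measurable_funM; first exact: measurable_powR.
exact: measurableT_comp.
Qed.

(** With [t = x^2] and [s = (n + 1) / 2] one has [t^(s - 1) dt = x^(n - 1) 2 x dx = 2 x^n dx]; the
    endpoint [a > 0] keeps to the region where the kernel is continuous. *)
Lemma gamma_kernel_subst n a b : 0 < a -> a <= b ->
  (\int[mu]_(t in `[(a ^+ 2)%R, (b ^+ 2)%R]) (gamma_kernel ((n%:R + 1) / 2) t)%:E =
   \int[mu]_(x in `[a, b]) (2 * gauss_moment n x)%:E)%E.
Proof.
move=> a0 ab.
have dE : derive1 (fun x : R => x ^+ 2) = (fun x => 2 * x).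
  by apply/funext => x; rewrite derive1E exp_derive expr1 [LHS]mulr1.
rewrite (@integration_by_substitution_increasing R (fun x => x ^+ 2))//.
- apply: eq_integral => x; rewrite inE/= in_itv/= => /andP[ax _].
  have x0 : 0 < x by exact: lt_le_trans ax.
  congr (_%:E); rewrite fctE /= dE /gamma_kernel /gauss_moment.
  rewrite -(powR_mulrn 2 (ltW x0)) -powRrM.
  have -> : 2%:R * ((n%:R + 1) / 2 - 1) = n%:R - 1 :> R by field.
  rewrite powRB ?(gt_eqF x0) ?implybT// powRr1 ?ltW// !powR_mulrn ?ltW//.
  by field; rewrite gt_eqF.
- move=> x y; rewrite !in_itv/= => /andP[ax _] /andP[ay _] xy.
  by rewrite ltrXn2r// (le_trans (ltW a0)).
- by rewrite dE => x _; exact: mulrl_continuous.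
- rewrite dE; apply/cvg_ex; exists (2 * a).
  by apply: cvg_at_right_filter; exact: mulrl_continuous.
- rewrite dE; apply/cvg_ex; exists (2 * b).
  by apply: cvg_at_left_filter; exact: mulrl_continuous.
- split; first by move=> x _; exact: exprn_derivable.
  + by apply: cvg_at_right_filter; exact: exprn_continuous.
  + by apply: cvg_at_left_filter; exact: exprn_continuous.
- apply: continuous_in_subspaceT => t; rewrite inE/= in_itv/= => /andP[at_ _].
  by apply: continuous_gamma_kernel; apply: lt_le_trans at_; rewrite exprn_gt0.
Qed.

(* The kernel may blow up at 0, and [increasing_ge0_integration_by_substitutiony]
   wants the derivative, here [2 v], to converge at infinity: so the substitution
   [t = v^2] is done on compact subintervals of ]0, oo[ and passed to the union. *)
Lemma gamma_kernel_subst_bigcup n (a b : R^nat) : (forall k, 0 < a k) ->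
  (forall k, a k <= b k) -> nonincreasing_seq a -> nondecreasing_seq b ->
  (\int[mu]_(t in \bigcup_k `[(a k ^+ 2)%R, (b k ^+ 2)%R]%classic)
     (gamma_kernel ((n%:R + 1) / 2) t)%:E =
   \int[mu]_(x in \bigcup_k `[a k, b k]%classic) (2 * gauss_moment n x)%:E)%E.
Proof.
move=> a0 ab na nb.
have b0 k : 0 < b k by exact: lt_le_trans (ab k).
have na2 : nonincreasing_seq (fun k => a k ^+ 2).
  move=> i j ij; rewrite lerXn2r ?nnegrE//; [exact: ltW|exact: ltW|exact: na].
have nb2 : nondecreasing_seq (fun k => b k ^+ 2).
  move=> i j ij; rewrite lerXn2r ?nnegrE//; [exact: ltW|exact: ltW|exact: nb].
have nd (u v : R^nat) : nonincreasing_seq u -> nondecreasing_seq v ->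
    {homo (fun k => `[u k, v k]%classic) : i j / (i <= j)%N >-> (i <= j)%O}.
  move=> nu nv i j ij; apply/subsetPset => x /=; rewrite !in_itv/=.
  move=> /andP[h1 h2]; apply/andP; split.
    exact: le_trans (nu _ _ ij) h1.
  exact: le_trans h2 (nv _ _ ij).
(* Monotone convergence along the increasing intervals; the two sequences of integrals agree term by
   term, hence so do their limits. *)
have h1 : (\int[mu]_(t in `[(a k ^+ 2)%R, (b k ^+ 2)%R]%classic)
     (gamma_kernel ((n%:R + 1) / 2) t)%:E)%E @[k --> \oo] -->
    (\int[mu]_(t in \bigcup_k `[(a k ^+ 2)%R, (b k ^+ 2)%R]%classic)
     (gamma_kernel ((n%:R + 1) / 2) t)%:E)%E.
  apply: (@ge0_nondecreasing_set_cvg_integral _ (measurableTypeR R) R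
    (fun k => `[a k ^+ 2, b k ^+ 2]%classic) (EFin \o gamma_kernel ((n%:R + 1) / 2))) => //.
  - exact: nd na2 nb2.
  - by move=> k; apply/measurable_EFinP; exact: measurable_gamma_kernel.
  - by move=> k x _; rewrite lee_fin mulr_ge0 ?powR_ge0 ?expR_ge0.
have h2 : (\int[mu]_(x in `[a k, b k]%classic) (2 * gauss_moment n x)%:E)%E @[k --> \oo] -->
    (\int[mu]_(x in \bigcup_k `[a k, b k]%classic) (2 * gauss_moment n x)%:E)%E.
  apply: (@ge0_nondecreasing_set_cvg_integral _ (measurableTypeR R) R
    (fun k => `[a k, b k]%classic) (fun x => (2 * gauss_moment n x)%:E)) => //.
  - exact: nd na nb.
  - move=> k; apply/measurable_EFinP/measurable_funM => //.
    exact: measurable_gauss_moment.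
  - move=> k x; rewrite /= in_itv/= => /andP[akx _].
    by rewrite lee_fin !mulr_ge0 ?expR_ge0 ?exprn_ge0// (le_trans _ akx)// ltW.
move: h1; under eq_fun do rewrite gamma_kernel_subst//.
by move=> h1; exact: cvg_unique h1 h2.
Qed.

(** Squaring is increasing on positive reals, so the union of the squared intervals can be read off
    from that of the original ones. *)
Lemma bigcup_sqr (a b : R^nat) : (forall k, 0 < a k) -> (forall k, a k <= b k) ->
  \bigcup_k `[(a k ^+ 2)%R, (b k ^+ 2)%R]%classic =
  [set t | 0 < t /\ (\bigcup_k `[a k, b k]%classic) (Num.sqrt t)].
Proof.
move=> a0 ab; apply/seteqP; split => t /=.
  move=> [k _ /=]; rewrite in_itv/= => /andP[at_ tb].
  have t0 : 0 < t by apply: lt_le_trans at_; rewrite exprn_gt0.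
  split => //; exists k => //=; rewrite in_itv/=.
  have b0 : 0 < b k by exact: lt_le_trans (ab k).
  rewrite -(ger0_norm (ltW (a0 k))) -sqrtr_sqr ler_wsqrtr//=.
  by rewrite -(ger0_norm (ltW b0)) -sqrtr_sqr ler_wsqrtr.
move=> [t0 [k _ /=]]; rewrite in_itv/= => /andP[at_ tb].
have b0 : 0 < b k by exact: lt_le_trans (ab k).
exists k => //=; rewrite in_itv/= -(sqr_sqrtr (ltW t0)).
by rewrite !lerXn2r ?nnegrE ?sqrtr_ge0 ?(ltW (a0 k)) ?(ltW b0).
Qed.

Lemma bigcup_itv0y :
  \bigcup_k `[(k.+1%:R^-1 : R), k.+1%:R]%classic = `]0, +oo[%classic.
Proof.
apply/seteqP; split => x /=.
  move=> [k _ /=]; rewrite !in_itv/= andbT => /andP[+ _].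
  by apply: lt_le_trans; rewrite invr_gt0.
rewrite in_itv/= andbT => x0.
have x1 : 0 <= x + x^-1 by rewrite addr_ge0// ?invr_ge0 ltW.
(* An integer above [x + x^-1] bounds both [x] and [x^-1], so one index serves both endpoints. *)
exists (Num.bound (x + x^-1)) => //=; rewrite in_itv/=.
have := archi_boundP x1; set N := Num.bound _ => h.
have xN : x + x^-1 <= N.+1%:R by rewrite (le_trans (ltW h))// ler_nat.
apply/andP; split; last by apply: le_trans xN; rewrite lerDl invr_ge0 ltW.
rewrite invf_ple ?posrE//; apply: le_trans xN; by rewrite lerDr ltW.
Qed.

Lemma bigcup_itv0c c : 0 < c ->
  \bigcup_k `[(c / k.+1%:R), c]%classic = `]0, c]%classic.
Proof.
move=> c0; apply/seteqP; split => x /=.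
  move=> [k _ /=]; rewrite !in_itv/= => /andP[+ ->]; rewrite andbT.
  by apply: lt_le_trans; rewrite divr_gt0.
rewrite in_itv/= => /andP[x0 xc].
have x1 : 0 <= c / x by rewrite divr_ge0// ltW.
exists (Num.bound (c / x)) => //=; rewrite in_itv/= xc andbT.
have := archi_boundP x1; set N := Num.bound _ => h.
rewrite ler_pdivrMr// mulrC -ler_pdivrMr//.
by rewrite (le_trans (ltW h))// ler_nat.
Qed.

Lemma integral_2gauss_moment n (i : interval R) :
  (\int[mu]_(x in [set` i]) (2 * gauss_moment n x)%:E =
   (2 * \int[mu]_(x in [set` i]) gauss_moment n x)%:E)%E.
Proof.
under eq_integral do rewrite EFinM.
rewrite integralZl//; last exact: integrable_gauss_moment_sub.
rewrite [in RHS]EFinM /Rintegral fineK//; apply: integrable_fin_num => //.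
exact: integrable_gauss_moment_sub.
Qed.

Lemma Gamma_gauss_tail n : Gamma ((n%:R + 1) / 2) = 2 * gauss_tail n 0.
Proof.
rewrite /Gamma -/(gamma_kernel _).
have i0 k : 0 < k.+1%:R^-1 :> R by rewrite invr_gt0.
have i1 k : k.+1%:R^-1 <= k.+1%:R :> R.
  by rewrite (@le_trans _ _ 1)// ?invf_le1// ler1n.
have := @gamma_kernel_subst_bigcup n (fun k => k.+1%:R^-1) (fun k => k.+1%:R) i0 i1.
rewrite bigcup_sqr// bigcup_itv0y.
have -> : [set t : R | 0 < t /\ `]0, +oo[%classic (Num.sqrt t)] = `]0, +oo[%classic.
  apply/seteqP; split => t /=; rewrite !in_itv/= !andbT; first by case.
  by move=> t0; rewrite sqrtr_gt0.
rewrite integral_2gauss_moment => ->.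
- by rewrite /= Rintegral_itv_obnd_cbnd//; exact: integrable_gauss_moment_sub.
- by move=> i j ij; rewrite lef_pV2 ?posrE// ler_nat.
- by move=> i j ij; rewrite ler_nat.
Qed.

Lemma lgamma_gauss_tail n c : 0 <= c ->
  lgamma ((n%:R + 1) / 2) (c ^+ 2) = 2 * (gauss_tail n 0 - gauss_tail n c).
Proof.
(* The substitution needs a positive endpoint, so [c = 0] is settled apart, over an empty
   interval. *)
rewrite le_eqVlt => /predU1P[<-|c0].
  by rewrite expr0n subrr mulr0 /lgamma set_itvoo0 integral_set0.
rewrite /lgamma -/(gamma_kernel _) integral_itv_bndo_bndc; last first.
  by apply/measurable_EFinP; exact: measurable_gamma_kernel.
have i0 k : 0 < c / k.+1%:R by rewrite divr_gt0.
have i1 k : c / k.+1%:R <= c by rewrite ler_pdivrMr// ler_peMr ?ler1n// ltW.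
have := @gamma_kernel_subst_bigcup n (fun k => c / k.+1%:R) (fun=> c) i0 i1.
rewrite bigcup_sqr// bigcup_itv0c//.
have -> : [set t : R | 0 < t /\ `]0, c]%classic (Num.sqrt t)] = `]0, (c ^+ 2)]%classic.
  apply/seteqP; split => t /=; rewrite !in_itv/=.
    move=> [t0 /andP[_ tc]]; rewrite t0 -(sqr_sqrtr (ltW t0)).
    by rewrite lerXn2r ?nnegrE ?sqrtr_ge0// ltW.
  move=> /andP[t0 tc]; split => //; rewrite sqrtr_gt0 t0/=.
  by rewrite -(ger0_norm (ltW c0)) -sqrtr_sqr ler_wsqrtr.
rewrite integral_2gauss_moment => ->.
- rewrite /= Rintegral_itv_obnd_cbnd; last exact: integrable_gauss_moment_sub.
  congr (2 * _).
  have := @Rintegral_itvB R (gauss_moment n) (BLeft 0) (BInfty _ false) c.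
  move=> /(_ (integrable_gauss_moment_sub _ (measurable_itv _))).
  rewrite bnd_simp ltW// bnd_simp => /(_ isT isT).
  rewrite Rintegral_itv_obnd_cbnd; last exact: integrable_gauss_moment_sub.
  by rewrite -/(gauss_tail n 0) -/(gauss_tail n c) => <-; rewrite opprB addrC subrK.
- by move=> i j ij; rewrite ler_pM2l// lef_pV2 ?posrE// ler_nat.
- by [].
Qed.

(** This is the origin of [cn]: for [m >= 0], reflecting the part over [[-m, 0]] yields [(-1)^n];
    for [m < 0] the tail starts at [-m > 0] and the incomplete integral is subtracted. *)
Lemma gauss_tail_lgamma n m :
  gauss_tail n (- m) = (Gamma ((n%:R + 1) / 2) +
    cn n m * lgamma ((n%:R + 1) / 2) (m ^+ 2)) / 2.
Proof.
rewrite Gamma_gauss_tail /cn; case: ifPn => [m0|].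
  by rewrite lgamma_gauss_tail// gauss_tailN//; field.
by rewrite -ltNge => m0; rewrite -sqrrN lgamma_gauss_tail ?oppr_ge0 ?ltW//; field.
Qed.

End gauss_moments.

(** * Decreasing affine change of variable on a half-line *)

Section affine.
Variable R : realType.
Notation mu := (@lebesgue_measure R).
Implicit Types a b c k : R.

Lemma ge0_integration_affineNy (G : R -> R) c k a : 0 < k ->
  continuous G -> (forall x, 0 <= G x) ->
  (\int[mu]_(x in `]-oo, (c - k * a)%R]) (G x)%:E =
   \int[mu]_(x in `[a, +oo[) (G (c - k * x) * k)%:E)%E.
Proof.
move=> k0 cG G0.
have dE : derive1 (fun x : R => c - k * x) = cst (- k).
  apply/funext => x; rewrite derive1E deriveB// derive_cst sub0r.
  by rewrite deriveZ// derive_id [_ *: _]mulr1.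
have cF : continuous (fun x : R => c - k * x).
  by move=> x; apply: cvgB; [exact: cvg_cst|exact: mulrl_continuous].
rewrite (@decreasing_ge0_integration_by_substitutiony R (fun x => c - k * x))//.
- apply: eq_integral => x _; congr (_%:E).
  change (G (c - k * x) * - derive1 (fun x : R => c - k * x) x =
    G (c - k * x) * k).
  by rewrite dE opprK.
- by move=> x y _ _ xy; rewrite ltrD2l ltrN2 ltr_pM2l.
- by rewrite dE => x _; exact: cst_continuous.
- by rewrite dE; exact: is_cvg_cst.
- by rewrite dE; exact: is_cvg_cst.
- split => //; first by apply: cvg_at_right_filter; exact: cF.
- apply/cvgrNyPle => A; near=> x.
  by rewrite lerBlDl -lerBlDr mulrC -ler_pdivrMr.
- exact: continuous_subspaceT.
Unshelve. all: by end_near. Qed.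

End affine.

(** * Convolution of two Gaussians with a polynomial weight *)

Section gauss_conv.
Variable R : realType.
Notation mu := (@lebesgue_measure R).

Lemma integral_pow_gauss_gauss (l1 l2 b : R) (j : nat) : 0 < l1 -> 0 < l2 ->
  (\int[mu]_(x in `]-oo, b])
    ((b - x) ^+ (2 * j) * expR (- ((b - x) ^+ 2 / l1)) * expR (- (x ^+ 2 / l2)))%:E =
  (expR (- (b ^+ 2 / l2) * (1 - l1 / (l1 + l2))) *
   \sum_(n < (2 * j).+1)
          'C(2 * j, n)%:R
          * (Gamma ((n%:R + 1) / 2)
             + cn n b * lgamma ((n%:R + 1) / 2) (b ^+ 2 / l2 * (l1 / (l1 + l2))))
          * (b / l2) ^+ (2 * j - n)
          / (2 * (l1^-1 + l2^-1) `^ ((2 * j)%:R + 2^-1 - n%:R / 2)))%:E)%E.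
Proof.
move=> l10 l20.
have l120 : 0 < l1 + l2 by exact: addr_gt0.
pose a := l1^-1 + l2^-1.
have a0 : 0 < a by rewrite addr_gt0// invr_gt0.
pose r := Num.sqrt a.
have r0 : 0 < r by rewrite sqrtr_gt0.
have rr : r ^+ 2 = a by rewrite sqr_sqrtr// ltW.
(* [m] is the centre of the completed square in [y = b - x]: [y^2 / l1 + (b - y)^2 / l2 = a (y -
   m)^2 + b^2 / (l1 + l2)]. *)
pose m := b / (l2 * a).
have mE : (m * r) ^+ 2 = b ^+ 2 / l2 * (l1 / (l1 + l2)).
  rewrite exprMn rr /m /a; field; rewrite !gt_eqF//= addrC gt_eqF//.
pose G x := (b - x) ^+ (2 * j) * expR (- ((b - x) ^+ 2 / l1)) * expR (- (x ^+ 2 / l2)).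
(* Under [x = b - m - v / r] the endpoint [x = b] corresponds to [v = - m r]. *)
have bE : b = (b - m) - r^-1 * (- (m * r)) by field; rewrite gt_eqF.
rewrite [in X in integral _ X _]bE (@ge0_integration_affineNy R G (b - m) r^-1); last 3 first.
- by rewrite invr_gt0.
- have cB : continuous (fun x : R => b - x).
    by move=> x; apply: cvgB; [exact: cvg_cst|exact: cvg_id].
  have cE l : continuous (fun x : R => expR (- (x ^+ 2 / l))).
    move=> x; apply: (@continuous_comp _ _ _ (fun x : R => - (x ^+ 2 / l)) expR).
      by apply: cvgN; apply: cvgM; [exact: exprn_continuous|exact: cvg_cst].
    exact: continuous_expR.
  move=> x; apply: cvgM; last exact: cE.
  apply: cvgM.
    apply: (@continuous_comp _ _ _ (fun x : R => b - x) (fun y : R => y ^+ (2 * j))).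
      exact: cB.
    exact: exprn_continuous.
  apply: (@continuous_comp _ _ _ (fun x : R => b - x) (fun y : R => expR (- (y ^+ 2 / l1)))).
    exact: cB.
  exact: cE.
- move=> x; rewrite /G !mulr_ge0 ?expR_ge0// exprM exprn_ge0 ?sqr_ge0//.
have GE x : G (b - m - r^-1 * x) / r =
   \sum_(n < (2 * j).+1) ('C(2 * j, n)%:R * (m ^+ (2 * j - n) / r ^+ n.+1) *
    expR (- (b ^+ 2 / l2) * (1 - l1 / (l1 + l2)))) * gauss_moment n x.
  rewrite /G.
  have -> : b - (b - m - r^-1 * x) = m + x / r by field; rewrite gt_eqF.
  rewrite -(mulrA (_ ^+ _) (expR _)) -expRD.
  have -> : - ((m + x / r) ^+ 2 / l1) + - ((b - m - r^-1 * x) ^+ 2 / l2) =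
      - (b ^+ 2 / l2) * (1 - l1 / (l1 + l2)) + - x ^+ 2.
    (* The coefficient [m a - b / l2] of the cross term is kept apart: it vanishes by the choice of
       [m]. *)
    transitivity (- (m ^+ 2 / l1 + (b - m) ^+ 2 / l2) - x ^+ 2 / r ^+ 2 * a
        - 2 * (x / r) * (m * a - b / l2)).
      by rewrite /a; field; rewrite !gt_eqF.
    rewrite rr divfK ?gt_eqF// /m /a; field.
    by rewrite !gt_eqF//= addrC gt_eqF.
  rewrite expRD exprDn !mulr_suml; apply: eq_bigr => n _.
  rewrite /gauss_moment -mulr_natl (exprMn n x) exprVn [r ^+ n.+1]exprS.
  set E := expR _; set E' := expR _; set u := m ^+ _; set v := r ^+ n.
  by field; rewrite expf_neq0 gt_eqF.
under eq_integral do rewrite GE -sumEFin.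
rewrite integral_sum//; last first.
  by move=> n; exact: (integrableZl _ _ (integrable_gauss_moment_sub _ _)).
rewrite mulr_sumr -sumEFin; apply: eq_bigr => n _.
under eq_integral do rewrite EFinM.
rewrite integralZl//; last exact: integrable_gauss_moment_sub.
rewrite gauss_tailE gauss_tail_lgamma mE -EFinM; congr (_%:E).
have n2j : (n <= 2 * j)%N by rewrite -ltnS.
have -> : m ^+ (2 * j - n) / r ^+ n.+1 =
    (b / l2) ^+ (2 * j - n) / a `^ ((2 * j)%:R + 2^-1 - n%:R / 2).
  (* Splitting the exponent: [a^(2j-n)] comes from [m^(2j-n)], and [a^((n+1)/2) = r^(n+1)] from the
     binomial term and the Jacobian. *)
  have -> : (2 * j)%:R + 2^-1 - n%:R / 2 = (2 * j - n)%:R + 2^-1 * n.+1%:R :> R.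
    by rewrite natrB// -natr1; field.
  rewrite powRD ?(gt_eqF a0) ?implybT// powR_mulrn ?ltW// powRrM.
  rewrite powR12_sqrt ?ltW// powR_mulrn ?ltW// -/r /m.
  rewrite invfM mulrA exprMn exprVn.
  set u := (b / l2) ^+ _; set v := a ^+ _; set w := r ^+ _.
  by field; rewrite !expf_neq0 ?gt_eqF.
(* [cn] depends only on the sign, and [m r] is a positive multiple of [b]. *)
have -> : cn n (m * r) = cn n b.
  by rewrite /cn /m -mulrA pmulr_lge0// mulr_gt0// invr_gt0 mulr_gt0.
rewrite -/a.
set G1 := Gamma _; set g1 := lgamma _ _; set E := expR _; set c := cn _ _.
set u := (b / l2) ^+ _; set v := a `^ _.
by field; rewrite gt_eqF// powR_gt0.
Qed.

End gauss_conv.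

(** * The tail of the chi law with an even number of degrees of freedom *)

Section chi.
Variable R : realType.
Notation mu := (@lebesgue_measure R).

(** This is the probability that a Poisson variable of mean [x^2 / 2] is less than [m]. *)
Definition chi_ccdf (m : nat) (x : R) : R :=
  expR (- (x ^+ 2 / 2)) * \sum_(j < m) (x ^+ 2 / 2) ^+ j / (j`!)%:R.

(** Telescoping: in [y = x^2 / 2], the derivative of [exp(-y) y^j / j!] is a difference of
    consecutive terms, so only the top one survives, times [dy/dx = x]. *)
Lemma is_derive_chi_ccdf (m : nat) (x : R) :
  is_derive x 1 (fun x => - chi_ccdf m.+1 x)
    (x * expR (- (x ^+ 2 / 2)) * ((x ^+ 2 / 2) ^+ m / (m`!)%:R)).
Proof.
have dY (y : R) : is_derive y 1 (fun x : R => x ^+ 2 / 2) y.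
  by apply: is_derive_eq; rewrite /GRing.scale/=; field.
have dE : is_derive x 1 (fun x : R => expR (- (x ^+ 2 / 2))) (- x * expR (- (x ^+ 2 / 2))).
  have h := @is_derive1_comp R expR (fun x : R => - (x ^+ 2 / 2)) x _ _
    (is_derive_expR _) (is_deriveN (dY x)).
  by apply: (is_derive_eq h); ring.
rewrite /chi_ccdf; elim: m => [|m ih].
  rewrite (_ : (fun _ => _) = (fun x : R => - expR (- (x ^+ 2 / 2)))).
    by apply: is_derive_eq; rewrite expr0 fact0; field.
  by apply/funext => y; rewrite big_ord1 expr0 fact0 divr1 mulr1.
have -> : (fun y : R => - (expR (- (y ^+ 2 / 2)) *
      \sum_(j < m.+2) (y ^+ 2 / 2) ^+ j / (j`!)%:R)) =
  (fun y : R => - (expR (- (y ^+ 2 / 2)) *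
      \sum_(j < m.+1) (y ^+ 2 / 2) ^+ j / (j`!)%:R)) +
  (fun y : R => - (expR (- (y ^+ 2 / 2)) * ((m.+1`!)%:R^-1 * (y ^+ 2 / 2) ^+ m.+1))).
  apply/funext => y; rewrite big_ord_recr/= mulrDr opprD; congr (_ - _ * _).
  exact: mulrC.
have dX : is_derive x 1 (fun y : R => (y ^+ 2 / 2) ^+ m.+1) (m.+1%:R * (x ^+ 2 / 2) ^+ m * x).
  by have h := is_deriveX m.+1 (dY x); rewrite exprfctE in h.
have h := is_deriveD ih (is_deriveN (is_deriveM dE (is_deriveZ ((m.+1)`!%:R^-1) dX))).
apply: (is_derive_eq h).
have -> : (x ^+ 2 / 2) ^+ m.+1 = (x ^+ 2 / 2) ^+ m * (x ^+ 2 / 2) by rewrite exprSr.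
have sc (a b : R) : a *: b = a * b by [].
rewrite /= factS natrM [_ ^+ m.+1]exprSr !sc.
set e := expR _; set u := _ ^+ m; field.
by rewrite pnatr_eq0 -lt0n fact_gt0 addrC natr1 pnatr_eq0.
Qed.

(** Puts the density in the shape of the derivative of [- chi_ccdf]. *)
Lemma chi2M_pdfE m (x : R) : 0 <= x ->
  chi2M_pdf m.+1 x = x * expR (- (x ^+ 2 / 2)) * ((x ^+ 2 / 2) ^+ m / (m`!)%:R).
Proof.
move=> x0; rewrite /chi2M_pdf x0.
have -> : (2 * m.+1).-1 = (2 * m).+1 by rewrite mulnS.
rewrite [_ ^+ (2 * m).+1]exprS exprM mulNr expr_div_n /=; field.
by rewrite expf_neq0 //= pnatr_eq0 -lt0n fact_gt0.
Qed.

Lemma chi2M_pdf_lt0 m (x : R) : x < 0 -> chi2M_pdf m x = 0.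
Proof. by rewrite /chi2M_pdf ltNge => /negbTE ->. Qed.

Lemma chi2M_cdf_lt0 M (z : R) : z < 0 ->
  (\int[mu]_(x in `]-oo, z]) (chi2M_pdf M x)%:E = 0)%E.
Proof.
move=> z0; apply: integral0_eq => x; rewrite /= in_itv/= => xz.
by rewrite chi2M_pdf_lt0// (le_lt_trans xz).
Qed.

(** The density vanishes below 0 and has primitive [- chi_ccdf] on [[0, z]], with value -1 at 0. *)
Lemma chi2M_cdf M (z : R) : (0 < M)%N -> 0 <= z ->
  (\int[mu]_(x in `]-oo, z]) (chi2M_pdf M x)%:E = (1 - chi_ccdf M z)%:E)%E.
Proof.
case: M => // m _ z0.
have -> : (\int[mu]_(x in `]-oo, z]) (chi2M_pdf m.+1 x)%:E =
    \int[mu]_(x in `[0%R, z]) (chi2M_pdf m.+1 x)%:E)%E.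
  rewrite [LHS]integral_mkcond [RHS]integral_mkcond; apply: eq_integral => x _.
  rewrite !patchE !mem_setE !in_itv/=.
  have [//|x0] := leP 0 x.
  by rewrite chi2M_pdf_lt0//; case: ifP.
have c0 : chi_ccdf m.+1 0 = 1.
  rewrite /chi_ccdf expr0n mul0r oppr0 expR0 mul1r big_ord_recl expr0 fact0.
  by rewrite big1 ?addr0 ?divr1// => i _; rewrite expr0n mul0r.
(* The fundamental theorem is applied on a nondegenerate interval, so [z = 0] is separate. *)
move: z0; rewrite le_eqVlt => /predU1P[<-|z0].
  by rewrite set_itv1 integral_set1 c0 subrr.
have dH (x : R) := is_derive_chi_ccdf m x.
have cH : continuous (fun x => - chi_ccdf m.+1 x).
  by move=> x; apply: differentiable_continuous; apply/derivable1_diffP; case: (dH x).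
pose f x : R := x * expR (- (x ^+ 2 / 2)) * ((x ^+ 2 / 2) ^+ m / (m`!)%:R).
have -> : (\int[mu]_(x in `[0%R, z]) (chi2M_pdf m.+1 x)%:E =
    \int[mu]_(x in `[0%R, z]) (f x)%:E)%E.
  apply: eq_integral => x; rewrite inE/= in_itv/= => /andP[x0 _].
  by rewrite chi2M_pdfE.
rewrite (@continuous_FTC2 R f (fun x => - chi_ccdf m.+1 x) 0 z z0).
- by rewrite -EFinB c0 opprK addrC.
- apply: continuous_subspaceT => x; rewrite /f.
  have cY : continuous (fun x : R => x ^+ 2 / 2).
    by move=> y; apply: cvgM; [exact: exprn_continuous|exact: cvg_cst].
  apply: cvgM.
    apply: cvgM; first exact: cvg_id.
    apply: (@continuous_comp _ _ _ (fun x : R => - (x ^+ 2 / 2)) expR).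
      by apply: cvgN; exact: cY.
    exact: continuous_expR.
  apply: cvgM; last exact: cvg_cst.
  apply: (@continuous_comp _ _ _ (fun x : R => x ^+ 2 / 2) (fun y : R => y ^+ m)).
    exact: cY.
  exact: exprn_continuous.
- split.
  + by move=> x _; case: (dH x).
  + by apply: cvg_at_right_filter; exact: cH.
  + by apply: cvg_at_left_filter; exact: cH.
- by move=> x _; rewrite derive1E; case: (dH x).
Qed.

End chi.

(** * The normal law of variance [l / 2] and the Q function *)

Section normal.
Variable R : realType.
Notation mu := (@lebesgue_measure R).

(** The real part of a circular complex Gaussian of variance [l] has variance [l / 2], which cancels
    the factors 2 in the density. *)
Lemma normal_pdf_half (l x : R) : 0 < l ->
  normal_pdf 0 (Num.sqrt (l / 2)) x = (Num.sqrt (pi * l))^-1 * expR (- (x ^+ 2 / l)).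
Proof.
move=> l0; have l20 : 0 < l / 2 by rewrite divr_gt0.
rewrite normal_pdfE ?gt_eqF ?sqrtr_gt0// /normal_peak /normal_fun subr0.
rewrite sqr_sqrtr ?ltW//.
have -> : l / 2 * pi *+ 2 = pi * l by rewrite -mulr_natr; field.
have -> : l / 2 *+ 2 = l by rewrite -mulr_natr; field.
by rewrite mulNr.
Qed.

(** The substitution [x = - s t], with [s] the standard deviation, makes the lower half-line a
    standard upper tail starting at [- b / s]. *)
Lemma normal_cdf_Qfun (l b : R) : 0 < l ->
  normal_prob 0 (Num.sqrt (l / 2)) `]-oo, b] =
  (Qfun (- (b * Num.sqrt 2) / Num.sqrt l))%:E.
Proof.
move=> l0; rewrite /normal_prob.
set s := Num.sqrt (l / 2).
have s0 : 0 < s by rewrite sqrtr_gt0 divr_gt0.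
set a := - _ / _.
have r2 : 0 < Num.sqrt 2 :> R by rewrite sqrtr_gt0.
have rl : 0 < Num.sqrt l by rewrite sqrtr_gt0.
have ss : s = Num.sqrt l / Num.sqrt 2 by rewrite /s sqrtrM ?(ltW l0)// sqrtrV.
have bE : b = 0 - s * a.
  by rewrite ss /a; field; rewrite !gt_eqF.
rewrite [in X in integral _ X _]bE (@ge0_integration_affineNy R _ 0 s)//; last 2 first.
- by apply: continuous_normal_pdf; rewrite gt_eqF.
- by move=> x; exact: normal_pdf_ge0.
have E (x : R) : normal_pdf 0 s (0 - s * x) * s =
    (Num.sqrt (2 * pi))^-1 * expR (- (x ^+ 2) / 2).
  rewrite normal_pdf_half// sub0r sqrrN exprMn sqr_sqrtr ?divr_ge0 ?ltW//.
  have -> : l / 2 * x ^+ 2 / l = x ^+ 2 / 2 by field; rewrite gt_eqF.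
  rewrite -mulNr [RHS]mulrC mulrAC [LHS]mulrC; congr (_ * _).
  rewrite ss !sqrtrM ?pi_ge0 ?ler0n//; field.
  by rewrite !gt_eqF ?sqrtr_gt0 ?pi_gt0.
have iE : mu.-integrable `[a, +oo[ (fun x => (expR (- (x ^+ 2) / 2))%:E).
  apply: (@integrableS _ _ _ mu setT) => //.
  have := integrableZl measurableT (@normal_peak R 1)^-1 (integrable_normal_pdf 0 1).
  apply: eq_integrable => // x _; rewrite normal_pdfE ?oner_neq0//.
  rewrite -EFinM mulKf ?gt_eqF ?normal_peak_gt0 ?oner_neq0//.
  by rewrite /normal_fun subr0 expr1n.
under eq_integral do rewrite E EFinM.
rewrite integralZl// /Qfun EFinM fineK//.
exact: integrable_fin_num.
Qed.

End normal.

(** * Laws of sums of independent variables *)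

Section independent_sum.
Context d (T : measurableType d) (R : realType) (P : probability T R).
Variables X N : {RV P >-> R}.
Notation mu := (@lebesgue_measure R).
Hypothesis indep : forall A B, measurable A -> measurable B ->
     P (X @^-1` A `&` N @^-1` B) = (P (X @^-1` A) * P (N @^-1` B))%E.

(** Independence gives equality with the product measure on rectangles, and these determine it. *)
Lemma joint_law (A : set (R * R)) : measurable A ->
  P [set w | A (X w, N w)] = (distribution P X \x distribution P N)%E A.
Proof.
move=> mA.
have mW : measurable_fun setT (fun w => (X w, N w)).
  exact: measurable_fun_pair.
pose W : {mfun T >-> (R * R)%type} := mfun_Sub (mem_set mW).
apply/esym.
by apply: (@product_measure_unique _ _ _ _ R (distribution P X) (distribution P N)
  (distribution P W)).
Qed.

Lemma measurable_sum_le (s b : R) :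
  measurable [set z : R * R | s * z.1 + z.2 <= b].
Proof.
rewrite -[X in measurable X]setTI.
have mf : measurable_fun setT (fun z : R * R => s * z.1 + z.2).
  by apply: measurable_funD => //; apply: measurable_funM.
have := mf measurableT `]-oo, b]%classic (measurable_itv _).
by congr (measurable _); apply/seteqP; split => z /=; rewrite in_itv.
Qed.

(** Tonelli for the law of [X] and Lebesgue measure weighted by the density [g]: this conditions on
    the value of [N]. *)
Lemma prob_sum_le (g : R -> R) (s b : R) :
  measurable_fun setT g -> (forall x, 0 <= g x) ->
  (forall A, measurable A -> P (N @^-1` A) = (\int[mu]_(x in A) (g x)%:E)%E) ->
  P [set w | s * X w + N w <= b] =
  (\int[mu]_y ((g y)%:E * P [set w | (s * X w <= b - y)%R]))%E.
Proof.
move=> mg g0 Ng.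
pose A := [set z : R * R | s * z.1 + z.2 <= b].
have mA : measurable A by exact: measurable_sum_le.
rewrite (joint_law mA) /product_measure1.
(* Integrating [f] first in [y] gives the law of [N] on an x-section of [A]; first in [x], it gives
   [g y] times the law of [X] on a y-section. *)
pose f (z : R * R) := ((g z.2)%:E * (\1_A z)%:E)%E.
transitivity (\int[distribution P X]_x \int[mu]_y f (x, y))%E.
  apply: eq_integral => x _ /=.
  have mx : measurable (xsection A x) by exact: measurable_xsection.
  rewrite [LHS](Ng _ mx) integral_mkcond; apply: eq_integral => y _.
  rewrite /f patchE /= indicE mem_xsection.
  by case: ifP => _; rewrite ?mule1 ?mule0.
rewrite (@fubini_tonelli _ _ _ _ R (distribution P X) mu f); last 2 first.
- apply: emeasurable_funM.
    apply/measurable_EFinP; exact: (measurableT_comp mg).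
  by apply/measurable_EFinP; exact: measurable_indic.
- by move=> z; rewrite mule_ge0 ?lee_fin.
apply: eq_integral => y _; rewrite /f /=.
rewrite ge0_integralZl//.
- congr (_ * _)%E.
  transitivity (\int[distribution P X]_x (\1_(ysection A y) x)%:E)%E.
    by apply: eq_integral => x _; rewrite !indicE mem_ysection.
  rewrite integral_indic ?setIT//; last exact: measurable_ysection.
  rewrite /distribution /pushforward; congr (P _).
  apply/seteqP; split => w /=; rewrite /ysection /= inE /A/=; by rewrite lerBrDr.
- apply/measurable_EFinP.
  rewrite (_ : (fun x => _) = \1_(ysection A y)).
    by apply: measurable_indic; exact: measurable_ysection.
  by apply/funext => x; rewrite !indicE mem_ysection.
- by rewrite lee_fin.
Qed.

(** For each value [x] of [X], the noise would have to hit the single point [c - s x]. *)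
Lemma prob_sum_atomless (s c : R) : (forall y, P (N @^-1` [set y]) = 0%E) ->
  P [set w | s * X w + N w = c] = 0%E.
Proof.
move=> N0.
pose A := [set z : R * R | s * z.1 + z.2 = c].
have mA : measurable A.
  rewrite -[X in measurable X]setTI.
  have mf : measurable_fun setT (fun z : R * R => s * z.1 + z.2).
    by apply: measurable_funD => //; apply: measurable_funM.
  exact: (mf measurableT [set c] (measurable_set1 c)).
rewrite (joint_law mA) /product_measure1; apply: integral0_eq => x _ /=.
rewrite -[RHS](N0 (c - s * x)); rewrite /distribution /pushforward; congr (P _).
apply/seteqP; split => w; rewrite /xsection /= inE /A/=.
  by move=> <-; rewrite addrC addKr.
by move=> ->; rewrite addrC subrK.
Qed.

End independent_sum.

(** * The distribution function of the real part of the observation *)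

Section cdf.
Context d (T : measurableType d) (R : realType) (P : probability T R).
Variables X N : {RV P >-> R}.
Notation mu := (@lebesgue_measure R).
Hypothesis indep : forall A B, measurable A -> measurable B ->
     P (X @^-1` A `&` N @^-1` B) = (P (X @^-1` A) * P (N @^-1` B))%E.
Variables (M : nat) (l1 l2 : R).
Hypotheses (M0 : (0 < M)%N) (l10 : 0 < l1) (l20 : 0 < l2).
Hypothesis Xchi : forall A, measurable A ->
     P (X @^-1` A) = (\int[lebesgue_measure]_(x in A) (chi2M_pdf M x)%:E)%E.
Hypothesis Nnormal : forall A, measurable A ->
     P (N @^-1` A) = normal_prob 0 (Num.sqrt (l2 / 2)) A.

(** The scale [sqrt (l1 / 2)] turns the [x^2 / 2] of the chi tail into [y^2 / l1]. *)
Lemma prob_scaled_chi_le (y : R) : P [set w | Num.sqrt (l1 / 2) * X w <= y] =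
  (if 0 <= y then 1 - expR (- (y ^+ 2 / l1)) *
     \sum_(j < M) y ^+ (2 * j) / (j`!%:R * l1 ^+ j) else 0)%:E.
Proof.
have s0 : 0 < Num.sqrt (l1 / 2) by rewrite sqrtr_gt0 divr_gt0.
have -> : [set w | Num.sqrt (l1 / 2) * X w <= y] =
    X @^-1` `]-oo, (y / Num.sqrt (l1 / 2))].
  by apply/seteqP; split => w /=; rewrite in_itv/= ler_pdivlMr// mulrC.
rewrite Xchi//; case: ifPn => [y0|]; last first.
  by rewrite -ltNge => y0; rewrite chi2M_cdf_lt0// pmulr_llt0// invr_gt0.
rewrite chi2M_cdf ?divr_ge0 ?(ltW s0)// /chi_ccdf.
have E : (y / Num.sqrt (l1 / 2)) ^+ 2 / 2 = y ^+ 2 / l1.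
  by rewrite expr_div_n sqr_sqrtr ?divr_ge0 ?ltW//; field; rewrite gt_eqF.
congr (_%:E); congr (1 - _ * _); first by rewrite E.
apply: eq_bigr => j _; rewrite E expr_div_n -exprM.
by field; rewrite expf_neq0 ?gt_eqF// ltr0n fact_gt0.
Qed.

Let h (b : R) (j : nat) (x : R) :=
  (b - x) ^+ (2 * j) * expR (- ((b - x) ^+ 2 / l1)) * expR (- (x ^+ 2 / l2)).

(** The integrand is nonnegative and its closed-form integral is a real number. *)
Let integrable_h b j : mu.-integrable `]-oo, b] (EFin \o h b j).
Proof.
have mexp (u : R -> R) l : measurable_fun setT u ->
    measurable_fun setT (fun x => expR (- (u x ^+ 2 / l))).
  move=> mu_; apply: measurableT_comp => //; apply: measurableT_comp => //.
  by apply: measurable_funM => //; exact: measurable_funX.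
have mb : measurable_fun setT (fun x : R => b - x) by exact: measurable_funB.
apply/integrableP; split.
  apply/measurable_EFinP; apply: measurable_funTS; apply: measurable_funM.
    by apply: measurable_funM; [exact: measurable_funX|exact: mexp].
  exact: mexp.
have -> : (\int[mu]_(x in `]-oo, b]) `|(EFin \o h b j) x| =
    \int[mu]_(x in `]-oo, b]) (h b j x)%:E)%E.
  apply: eq_integral => x _; rewrite /= ger0_norm// /h.
  by rewrite !mulr_ge0 ?expR_ge0// exprM exprn_ge0 ?sqr_ge0.
by rewrite integral_pow_gauss_gauss// ltry.
Qed.

Lemma prob_scaled_chi_normal_le (b : R) :
  P [set w | Num.sqrt (l1 / 2) * X w + N w <= b] = (cdf_formula M l1 l2 b)%:E.
Proof.
rewrite (prob_sum_le indep _ _ (measurable_normal_pdf 0 (Num.sqrt (l2 / 2))))//; last first.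
  by move=> x; exact: normal_pdf_ge0.
(* The denominator joins [j! l1^j] from the chi tail and [sqrt (pi l2)] from the normal density. *)
pose c j : R := ((j`!)%:R * l1 ^+ j * Num.sqrt (pi * l2))^-1.
(* The scaled chi variable is nonnegative, so only noise values [y <= b] contribute. *)
transitivity (\int[mu]_(y in `]-oo, b]) ((normal_pdf 0 (Num.sqrt (l2 / 2)) y)%:E -
    \sum_(j < M) (c j)%:E * (h b j y)%:E))%E.
  rewrite [RHS]integral_mkcond; apply: eq_integral => y _.
  rewrite prob_scaled_chi_le patchE mem_setE in_itv/= subr_ge0.
  case: ifP => _; last by rewrite mule0.
  rewrite sumEFin -EFinB -EFinM mulrBr mulr1; congr (_ - _)%:E.
  rewrite !mulr_sumr; apply: eq_bigr => j _; rewrite normal_pdf_half// /h /c.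
  set E := expR _; set E' := expR _; set u := (b - y) ^+ _.
  field.
  by rewrite expf_neq0 ?gt_eqF// ?sqrtr_gt0 ?mulr_gt0 ?pi_gt0// ltr0n fact_gt0.
have icj j : mu.-integrable `]-oo, b] (fun y => (c j)%:E * (h b j y)%:E)%E.
  exact: (integrableZl _ _ (integrable_h b j)).
have inorm : mu.-integrable `]-oo, b] (fun y => (normal_pdf 0 (Num.sqrt (l2 / 2)) y)%:E).
  by apply: integrableS (integrable_normal_pdf _ _).
rewrite integralB//; last first.
  by apply: (integrable_sum _ (index_enum 'I_M)) => // j _; exact: icj.
rewrite integral_sum//.
rewrite -[X in (X - _)%E]/(normal_prob _ _ _) normal_cdf_Qfun// EFinB; congr (_ - _)%E.
rewrite -sumEFin; apply: eq_bigr => j _.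
rewrite integralZl//; last exact: integrable_h.
rewrite integral_pow_gauss_gauss// -EFinM; congr (_%:E).
by rewrite mulrCA -[RHS]mulrA.
Qed.

End cdf.

(** * The repetition event and its probability *)

(* The disjunct [r = 0] is an artefact of [x / 0 = 0] in [alpha_hat]; on paper
   the estimate is infinite there and the pilot is not repeated. *)
Lemma repeatsE (R : realType) M (q rho beta tau sigma2 eps r : R) :
  0 < q -> 0 < rho -> 0 < sigma2 -> eps < rho * beta * tau / 2 ->
  0 < rho * beta * tau ->
  repeats M q rho beta tau sigma2 eps r <->
  [\/ r = 0, Num.sqrt (zeta M q rho beta tau sigma2 eps) < r |
      r < - Num.sqrt (zeta M q rho beta tau sigma2 eps)].
Proof.
move=> q0 rho0 s0 eps0; rewrite /repeats /alpha_hat /zeta.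
set A := rho * beta * tau; set C := _ * tau ^+ 2; set D := sigma2 + _ => A0.
have C0 : 0 <= C.
  by do 4 rewrite mulr_ge0 ?sqr_ge0 ?(ltW q0) ?(ltW rho0)//.
have D0 : 0 < D by rewrite /D; move: eps0; rewrite -/A => eps0; lra.
have DE : D = sigma2 + 2 * (A - eps) by [].
(* The argument [A] of the maximum asks for [A < 2 (A - eps)], which is the bound on the bias; the
   condition on the other argument remains. *)
have -> : (Num.max (C / r ^+ 2 - sigma2) A / 2 + eps < A) = (C / r ^+ 2 < D).
  rewrite -ltrBrDr ltr_pdivrMr// gt_max.
  have -> : A < (A - eps) * 2 by move: eps0; rewrite -/A => eps0; lra.
  by rewrite andbT ltrBlDr; congr (_ < _); rewrite DE; ring.
have [->|r0] := eqVneq r 0.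
  by rewrite expr0n invr0 mulr0; split => // _; constructor 1.
have r2 : 0 < r ^+ 2 by rewrite exprn_even_gt0.
have -> : (C / r ^+ 2 < D) = (Num.sqrt (C / D) < `|r|).
  by rewrite -sqrtr_sqr ltr_sqrt// !ltr_pdivrMr// mulrC.
rewrite ltr_normr; split.
  by case/orP => h; [constructor 2|constructor 3; rewrite ltrNr].
case => [r00|->//|h]; first by rewrite r00 eqxx in r0.
by rewrite orbC ltrNr h.
Qed.

Theorem theorem2 (R : realType)
  (* UEs, pilot set S_t, the considered UE k, powers and large-scale gains *)
  (I : finType) (S : {set I}) (k : I) (rho beta : I -> R)
  (M tau_p : nat) (q sigma2 omega Upsilon eps : R)
  (* probability space; X ~ chi_{2M}, N = Re(nu_k) ~ N(0, lambda2/2) *)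
  (d : measure_display) (T : measurableType d) (P : probability T R)
  (X N : {RV P >-> R}) :
  (0 < M)%N -> (0 < tau_p)%N ->
  0 < q -> 0 < sigma2 -> 0 <= omega -> 0 <= Upsilon ->
  (forall i, 0 < rho i) -> (forall i, 0 < beta i) ->
  k \in S ->
  let tau := (tau_p%:R : R) in
  let alpha := \sum_(i in S) rho i * beta i * tau + omega in
  let lambda1 := rho k * q * beta k ^+ 2 * tau ^+ 2 / (alpha + sigma2) in
  let lambda2 := sigma2 + Upsilon + q * beta k * tau - lambda1 in
  eps < rho k * beta k * tau / 2 ->
  (forall A, measurable A ->
     P (X @^-1` A) = (\int[lebesgue_measure]_(x in A) (chi2M_pdf M x)%:E)%E) ->
  (forall A, measurable A ->
     P (N @^-1` A) = normal_prob 0 (Num.sqrt (lambda2 / 2)) A) ->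
  (forall A B, measurable A -> measurable B ->
     P (X @^-1` A `&` N @^-1` B) = (P (X @^-1` A) * P (N @^-1` B))%E) ->
  (* Re(z_k) = Re(g_k) + Re(nu_k), g_k = sqrt(lambda1/2) x *)
  let Rez := fun w : T => Num.sqrt (lambda1 / 2) * X w + N w in
  let zk := zeta M q (rho k) (beta k) tau sigma2 eps in
  P [set w | repeats M q (rho k) (beta k) tau sigma2 eps (Rez w)]
    = (1 - P [set w | (Rez w <= Num.sqrt zk)%R] + P [set w | (Rez w <= - Num.sqrt zk)%R])%E
  /\ (forall b : R,
        P [set w | Rez w <= b] = (cdf_formula M lambda1 lambda2 b)%:E).
Proof.
move=> M0 tau0 q0 sig0 om0 Up0 rho0 beta0 kS tau alpha lambda1 lambda2 heps
  Xchi Nnormal indep Rez zk.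
have t0 : 0 < tau by rewrite ltr0n.
have A0 : 0 < rho k * beta k * tau by rewrite !mulr_gt0.
have alphaA : rho k * beta k * tau <= alpha.
  rewrite /alpha (bigD1 k)//= -addrA lerDl addr_ge0// sumr_ge0// => i _.
  by rewrite !mulr_ge0 ?ltW.
have as0 : 0 < alpha + sigma2 by rewrite addr_gt0// (lt_le_trans A0).
have l10 : 0 < lambda1 by rewrite divr_gt0// !mulr_gt0// exprn_gt0.
(* UE [k] itself contributes to [alpha], so [lambda1] is at most [q * beta k * tau] and at least
   [sigma2 + Upsilon > 0] is left. *)
have l20 : 0 < lambda2.
  have : lambda1 <= q * beta k * tau.
    rewrite /lambda1 ler_pdivrMr//.
    have -> : rho k * q * beta k ^+ 2 * tau ^+ 2 =
      q * beta k * tau * (rho k * beta k * tau) by ring.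
    rewrite ler_pM2l ?mulr_gt0//; by rewrite (le_trans alphaA)// lerDl ltW.
  by rewrite /lambda2; lra.
split; last by move=> b; exact: prob_scaled_chi_normal_le.
(* The normal law has no atoms and an independent summand creates none; so the event [Rez w = 0] and
   the endpoints of the inequalities are negligible. *)
have Rez_eq c : P [set w | Rez w = c] = 0%E.
  apply: prob_sum_atomless => // y.
  by rewrite Nnormal// /normal_prob integral_set1.
have mRez : measurable_fun setT Rez.
  by apply: measurable_funD => //; apply: measurable_funM.
have mpre B : measurable B -> measurable (Rez @^-1` B).
  by move=> mB; rewrite -[X in measurable X]setTI; exact: mRez.
set z := Num.sqrt zk.
have z0 : 0 <= z by exact: sqrtr_ge0.
have mle c : measurable [set w | Rez w <= c].
  have := mpre _ (measurable_itv `]-oo, c]).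
  by congr measurable; apply/seteqP; split => w /=; rewrite in_itv.
have mlt c : measurable [set w | Rez w < c].
  have := mpre _ (measurable_itv `]-oo, c[).
  by congr measurable; apply/seteqP; split => w /=; rewrite in_itv.
have meq c : measurable [set w | Rez w = c] by exact: mpre (measurable_set1 c).
have -> : [set w | repeats M q (rho k) (beta k) tau sigma2 eps (Rez w)] =
    (~` [set w | Rez w <= z] `|` [set w | Rez w < - z]) `|` [set w | Rez w = 0].
  apply/seteqP; split => w /=.
    move=> /(repeatsE _ _ q0 (rho0 k) sig0 heps A0)[?|?|?]; first by right.
      by left; left; apply/negP; rewrite -ltNge.
    by left; right.
  move=> h; apply/(repeatsE _ _ q0 (rho0 k) sig0 heps A0).
  case: h => [[/negP|?]|?]; [|by constructor 3|by constructor 1].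
  by rewrite -ltNge => ?; constructor 2.
rewrite measureU0//; [|by apply: measurableU => //; exact: measurableC|exact: Rez_eq].
rewrite measureU//; [|exact: measurableC|].
  congr (_ + _)%E; first exact: (probability_setC P (mle z)).
  (* Adding the null event [Rez w = - z] passes from the strict inequality to the weak one. *)
  have -> : [set w | Rez w <= - z] = [set w | Rez w < - z] `|` [set w | Rez w = - z].
    apply/seteqP; split => w /=; rewrite le_eqVlt.
      by case/predU1P => ?; [right|left].
    by case => [->|->]; rewrite ?eqxx ?orbT.
  by rewrite measureU0//; exact: Rez_eq.
(* The two events are disjoint because [- z <= 0 <= z]. *)
apply/seteqP; split => w //= [/negP]; rewrite -ltNge => h1 h2.
by move: (lt_trans h1 h2); rewrite ltNge (le_trans _ z0)// oppr_le0.
Qed.
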